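(* Let $T$ be a linear transformation on an $n$-dimensional Hilbert space $V$ with distinct eigenvalues $z_1,\dots,z_n\in\Omega$, let $v_1,\dots,v_n$ be linearly independent eigenvectors of $T^*$ with $T^*v_i=\bar z_iv_i$, let $\sigma=\{z_1,\dots,z_n\}$, and let $K$ be the positive definite function on $\sigma\times\sigma$ given by $K(z_j,z_i)=\langle v_i,v_j\rangle$. If for some $\boldsymbol{\alpha}\in\mathbb{T}^m$ the kernel $K$ is the Schur product of a positive definite matrix $A=(a_{ij})$ and the restriction of $K_{\boldsymbol\alpha}$ to $\sigma\times\sigma$, that is, $$K(z_j,z_i)=K_{\boldsymbol\alpha}(z_j,z_i)\,a_{ij},\qquad 1\le i,j\le n,$$ then the homomorphism $\rho_T$ is dilatable to a homomorphism of the form $$\rho_{M\otimes I}:\mathcal{A}(\Omega)\to\mathcal{B}(H^2_{\boldsymbol\alpha}(\Omega)\otimes\mathbb{C}^n)$$ for some $\boldsymbol{\alpha}\in\mathbb{T}^m$.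
   Context: $\Omega\subseteq\mathbb{C}$ is a finitely connected bounded domain whose boundary is the disjoint union of simple analytic closed curves; $m$ is the number of bounded connected components of $\mathbb{C}\setminus\Omega$ and $\mathbb{T}$ is the unit circle. $\mathcal{A}(\Omega)$ is the closure, in the supremum norm on $\Omega$, of the algebra of rational functions with poles off $\overline{\Omega}$, and $\rho_T:\mathcal{A}(\Omega)\to\mathcal{B}(V)$ is $f\mapsto f(T)$. An element $\boldsymbol\alpha\in\mathbb{T}^m$ determines a character of $\pi_1(\Omega)$. $H^2_{\boldsymbol\alpha}(\Omega)$ is the Hilbert space of modulus automorphic (multivalued) holomorphic functions $h$ on $\Omega$ with this character, i.e. continuation of $h$ along a loop around the $i$-th hole multiplies it by $\alpha_i$, such that the single-valued function $|h|^2$ has a harmonic majorant on $\Omega$; $\|h\|^2$ is the value of the least harmonic majorant at a fixed base point. Point evaluations (on a fixed branch, e.g. after cutting $\Omega$ to a simply connected set containing the points under consideration, or at fixed lifts to the universal cover) are bounded, and $K_{\boldsymbol\alpha}(z,w)$ is the reproducing kernel. $M$ is multiplication by the coordinate function on $H^2_{\boldsymbol\alpha}(\Omega)$, and $\rho_{M\otimes I}(f)=M_f\otimes I$. ''Positive definite'' for the matrix $A$ is used in the sense of nonnegative definite, i.e. $a_{ij}=\langle a_i,a_j\rangle$ for some vectors $a_1,\dots,a_n\in\mathbb{C}^n$. ''$\rho_T$ is dilatable to $\rho_{M\otimes I}$'' means: there is an isometric embedding of $V$ in $H^2_{\boldsymbol\alpha}(\Omega)\otimes\mathbb{C}^n$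 such that $P\rho_{M\otimes I}(f)|_V=\rho_T(f)$ for all $f\in\mathcal{A}(\Omega)$, where $P$ is the orthogonal projection onto $V$. *)

(* Defs.v *)
From HB Require Import structures.
From mathcomp Require Import all_boot all_order all_algebra.
From mathcomp Require Import complex.
From mathcomp Require Import all_classical all_reals all_analysis.

Set Implicit Arguments.
Unset Strict Implicit.
Unset Printing Implicit Defensive.

Import Order.TTheory GRing.Theory Num.Theory.
Import numFieldNormedType.Exports.

Local Open Scope classical_set_scope.
Local Open Scope ring_scope.

(* [R[i]^o] is the complex plane as a normed
   space over the field [R[i]], so [derivable f z 1] is complex
   differentiability at z. *)

Section ComplexDomains.
Variable R : realType.
Local Notation C := (R[i]^o).

Definition holomorphic_on (U : set C) (f : C -> C) : Prop :=
  forall z, U z -> derivable f z 1.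

Definition unit_circle : set C := [set w : C | `|w| = 1].

(* S is the image of the unit circle under a parametrisation which is
   holomorphic near the circle, injective on it, with nonzero derivative. *)
Definition simple_analytic_closed_curve (S : set C) : Prop :=
  exists (U : set C) (phi : C -> C),
    [/\ open U, unit_circle `<=` U & holomorphic_on U phi] /\
    [/\ set_inj unit_circle phi,
        forall w, unit_circle w -> 'D_1 phi w != 0
      & S = phi @` unit_circle].

Definition is_component (A B : set C) : Prop :=
  exists2 x, A x & B = connected_component A x.

(* [hole] lists without repetition the bounded components of the complement,
   so [m] is their number. *)
Record analytic_domain (Om : set C) (m : nat) (hole : 'I_m -> set C) : Prop := {
  domain_open : open Om;
  domain_connected : connected Om;
  domain_nonempty : Om !=set0;
  domain_bounded : bounded_set Om;
  domain_boundary : exists (k : nat) (S : 'I_k -> set C),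
    [/\ forall j, simple_analytic_closed_curve (S j),
        forall j j', j != j' -> S j `&` S j' = set0
      & closure Om `\` Om = \bigcup_(j in [set: 'I_k]) S j];
  hole_inj : injective hole;
  holeP : forall B, (is_component (~` Om) B /\ bounded_set B) <->
                    exists i, hole i = B
}.

(* C^2 with vanishing Laplacian, in the real coordinates (x, y). *)
Definition harmonic_on (U : set C) (u : C -> R) : Prop :=
  let u2 := fun p : R * R => u (p.1 +i* p.2)%C in
  let axis := [set ((1, 0) : R * R); ((0, 1) : R * R)] in
  forall p : R * R, U (p.1 +i* p.2)%C ->
    (forall d, axis d -> derivable u2 p d) /\
    (forall d e, axis d -> axis e ->
       derivable ('D_d u2) p e /\ {for p, continuous ('D_e ('D_d u2))}) /\
    'D_(1, 0) ('D_(1, 0) u2) p + 'D_(0, 1) ('D_(0, 1) u2) p = 0.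

End ComplexDomains.

(* The universal cover of Om is the set of homotopy classes of paths starting
   at the base point.  Paths are functions on [R] of which only the restriction
   to [0, 1] matters. *)
Section Paths.
Variable R : realType.
Local Notation C := (R[i]^o).

Definition is_path (Om : set C) (a b : C) (g : R -> C) : Prop :=
  [/\ {within `[0, 1], continuous g},
      forall t, `[0, 1]%classic t -> Om (g t), g 0 = a & g 1 = b].

Definition path_cat (g d : R -> C) : R -> C :=
  fun t => if t <= 2^-1 then g (2 * t) else d (2 * t - 1).

Definition segment (a b : C) : R -> C := fun t => a + t%:C%C * (b - a).

Definition path_homotopic (Om : set C) (a b : C) (g d : R -> C) : Prop :=
  exists H : R * R -> C,
    [/\ {within `[0, 1] `*` `[0, 1], continuous H},
        forall s t, `[0, 1]%classic s -> `[0, 1]%classic t -> Om (H (s, t)),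
        forall s, `[0, 1]%classic s -> H (s, 0) = a /\ H (s, 1) = b
      & forall t, `[0, 1]%classic t -> H (0, t) = g t /\ H (1, t) = d t].

(* k is the winding number of the loop l about a, through a continuous choice
   of the argument along l. *)
Definition winding_number (l : R -> C) (a : C) (k : int) : Prop :=
  exists theta : R -> R,
    [/\ {within `[0, 1], continuous theta},
        forall t, `[0, 1]%classic t ->
          l t - a = `|l t - a| * (cos (theta t) +i* sin (theta t))%C
      & theta 1 - theta 0 = 2 * pi * k%:~R].

End Paths.

Section Hardy.
Variable R : realType.
Local Notation C := (R[i]^o).

(* A multivalued function on Om: its value at a path from the base point t0 is
   the value at the endpoint of the continuation along the path. *)
Definition mvfun : Type := (R -> C) -> R[i].

Variables (Om : set C) (t0 : C) (m : nat) (hole : 'I_m -> set C).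

Definition unimodular (alpha : 'I_m -> R[i]) : Prop :=
  forall i, `|alpha i| = 1.

Definition single_valued_on_cover (h : mvfun) : Prop :=
  forall b g d, is_path Om t0 b g -> is_path Om t0 b d ->
    path_homotopic Om t0 b g d -> h g = h d.

(* On a disc in Om around the end b of a path g, continuing h along radii gives
   a holomorphic branch. *)
Definition mv_holomorphic (h : mvfun) : Prop :=
  forall b g (r : R[i]), is_path Om t0 b g -> ball b r `<=` Om ->
    holomorphic_on (ball b r) (fun w => h (path_cat g (segment b w))).

(* The character of pi_1(Om, t0) given by alpha takes the value
   \prod_i alpha_i ^ k_i at a loop winding k_i times around the i-th hole. *)
Definition automorphic (alpha : 'I_m -> R[i]) (h : mvfun) : Prop :=
  forall l (k : 'I_m -> int) b g,
    is_path Om t0 t0 l -> is_path Om t0 b g ->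
    (forall i a, hole i a -> winding_number l a (k i)) ->
    h (path_cat l g) = (\prod_(i < m) alpha i ^ k i) * h g.

Definition harmonic_majorant (h : mvfun) (u : C -> R) : Prop :=
  harmonic_on Om u /\
  forall b g, is_path Om t0 b g -> `|h g| ^+ 2 <= (u b)%:C%C.

Definition least_harmonic_majorant (h : mvfun) (u : C -> R) : Prop :=
  harmonic_majorant h u /\
  forall w, harmonic_majorant h w -> forall z, Om z -> u z <= w z.

Definition H2 (alpha : 'I_m -> R[i]) : set mvfun :=
  [set h | [/\ single_valued_on_cover h, mv_holomorphic h,
               automorphic alpha h & exists u, harmonic_majorant h u]].

Definition H2_normsq (h : mvfun) : R :=
  xget (fun=> 0) [set u | least_harmonic_majorant h u] t0.

(* Polarization; linear in the first argument. *)
Definition H2_inner (f g : mvfun) : R[i] :=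
  4^-1 * \sum_(k < 4)
    'i%C ^+ k * (H2_normsq (fun p => f p + 'i%C ^+ k * g p))%:C%C.

(* Kernels live on pairs of points of the universal cover. *)
Definition reproducing_kernel (alpha : 'I_m -> R[i])
    (K : (R -> C) -> (R -> C) -> R[i]) : Prop :=
  forall b d, is_path Om t0 b d ->
    H2 alpha (K ^~ d) /\
    forall h, H2 alpha h -> H2_inner h (K ^~ d) = h d.

(* The Hilbert space H2 alpha (x) C^n, an element \sum_k x_k (x) e_k being
   represented by its coordinates x_k. *)
Definition H2n (alpha : 'I_m -> R[i]) (n : nat) : set ('I_n -> mvfun) :=
  [set x | forall k, H2 alpha (x k)].

Definition H2n_inner (n : nat) (x y : 'I_n -> mvfun) : R[i] :=
  \sum_(k < n) H2_inner (x k) (y k).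

(* M_f (x) I; here p 1 is the point of Om below the point p of the cover. *)
Definition mult_op (n : nat) (f : C -> C) (x : 'I_n -> mvfun) : 'I_n -> mvfun :=
  fun k p => f (p 1) * x k p.

Definition orth_proj (n : nat) (S : set ('I_n -> mvfun))
    (x y : 'I_n -> mvfun) : Prop :=
  S y /\ forall s, S s -> H2n_inner (fun k p => x k p - y k p) s = 0.

End Hardy.

Section FunctionalCalculus.
Variable R : realType.
Local Notation C := (R[i]^o).
Variable Om : set C.

(* Rational functions are numerator/denominator pairs. *)
Definition poles_off_closure (r : {poly R[i]} * {poly R[i]}) : Prop :=
  forall z : C, closure Om z -> r.2.[z] != 0.

Definition rat_eval (r : {poly R[i]} * {poly R[i]}) : C -> C :=
  fun z => r.1.[z] / r.2.[z].

Definition rat_approx (r : nat -> {poly R[i]} * {poly R[i]}) (f : C -> C) :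
    Prop :=
  (forall k, poles_off_closure (r k)) /\
  {uniform Om, (fun k => rat_eval (r k)) @ \oo --> f}.

Definition algebraA : set (C -> C) := [set f | exists r, rat_approx r f].

Variables (V : vectType R[i]) (dot : {dot V for @Num.conj R[i]}).

Definition is_adjoint (T S : 'End(V)) : Prop :=
  forall u w, dot (T u) w = dot u (S w).

Definition poly_lfun (p : {poly R[i]}) (T : 'End(V)) : 'End(V) :=
  \sum_(i < size p) p`_i *: iter i (comp_lfun T) \1%VF.

Definition rat_lfun (r : {poly R[i]} * {poly R[i]}) (T : 'End(V)) : 'End(V) :=
  (poly_lfun r.1 T \o (poly_lfun r.2 T)^-1)%VF.

(* Convergence in operator norm. *)
Definition lfun_cvg (F : nat -> 'End(V)) (G : 'End(V)) : Prop :=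
  forall e : R[i], 0 < e -> \forall k \near \oo, forall u : V,
    dot ((F k - G) u) ((F k - G) u) <= e ^+ 2 * dot u u.

(* f(T) is the limit of r_k(T) for rational r_k converging to f uniformly
   on Om. *)
Definition rho (T : 'End(V)) (f : C -> C) : 'End(V) :=
  xget 0 [set F | exists2 r, rat_approx r f
                           & lfun_cvg (fun k => rat_lfun (r k) T) F].

End FunctionalCalculus.

Section Dilation.
Variable R : realType.
Local Notation C := (R[i]^o).

(* Nonnegative definite, as a Gram matrix. *)
Definition positive_definite (n : nat) (A : 'M[R[i]]_n) : Prop :=
  exists a : 'I_n -> 'rV[R[i]]_n,
    forall i j, A i j = \sum_(k < n) a i 0 k * Num.conj (a j 0 k).

Definition dilatable (Om : set C) (t0 : C) (m : nat) (hole : 'I_m -> set C)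
    (alpha : 'I_m -> R[i]) (n : nat) (V : vectType R[i])
    (dot : {dot V for @Num.conj R[i]}) (T : 'End(V)) : Prop :=
  (forall f (x : 'I_n -> mvfun R), algebraA Om f ->
     H2n Om t0 hole alpha x -> H2n Om t0 hole alpha (mult_op f x)) /\
  exists W : V -> 'I_n -> mvfun R,
    [/\ forall u, H2n Om t0 hole alpha (W u),
        forall (a : R[i]) u w k p,
          W (a *: u + w) k p = a * W u k p + W w k p,
        forall u w, H2n_inner Om t0 (W u) (W w) = dot u w
      & forall f, algebraA Om f -> forall u,
          orth_proj Om t0 (range W) (mult_op f (W u)) (W (rho Om dot T f u))].

End Dilation.

(* Main.v *)
Require Import Defs.
From HB Require Import structures.
From mathcomp Require Import all_boot all_order all_algebra.
From mathcomp Require Import complex.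
From mathcomp Require Import all_classical all_reals all_analysis.
From mathcomp Require Import zify ring lra.
From mathcomp Require cyclic separable cyclotomic.

(** Write the positive definite matrix as a Gram matrix, A i j = <a_i, a_j> with
    a_i in C^n, and let k_i be the kernel function of H^2_alpha at the lift c_i
    of z_i. The linear map W with W v_i = k_i (x) a_i is an isometric embedding,
    because <W v_i, W v_j> = K_alpha(c_j, c_i) A i j = <v_i, v_j>. Since M_f
    multiplies the evaluation at c_j by f(z_j), for x in H^2 (x) C^n
    <M_f x, W v_j> = f(z_j) <x, W v_j>, and since T^* v_j = conj(z_j) v_j also
    <f(T) u, v_j> = f(z_j) <u, v_j>. Hence M_f W u - W f(T) u is orthogonal to
    the range of W, which is the dilation property (embed_isometry,
    embed_orth_proj).

    This uses the inner product of H^2_alpha, which is a polarization sum of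
    values N(h) at the base point of least harmonic majorants of |h|^2, only
    against combinations of kernel functions. There it is computed from the
    reproducing property itself: together with N(c h) = |c|^2 N(h) it forces
      N(h + b k_d) = N(h) + 2 Re(conj(b) h(d)) + |b|^2 K(d, d)
    for all complex b (H2_normsq_kernel). Iterating over several kernel functions
    and polarizing gives <h, sum_j b_j k_j> = sum_j conj(b_j) h(c_j)
    (H2_inner_kernel_sum).

    That M_f preserves H^2_alpha needs members of A(Omega) to be bounded and
    holomorphic. For the latter (algebraA_holomorphic), a rational function is a
    uniform limit of polynomials on any disc free of its poles, hence so is every
    member of A(Omega) on discs inside Omega; and a uniform limit of polynomials
    is differentiable at the centre, because Cauchy's estimates for polynomials
    bound the remainder of their first order expansion uniformly.

    Finally the limit defining f(T) exists (rat_lfun_cvg): the eigenvectors of T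
    form a basis dual to the v_j up to scaling, in which all r(T) are diagonal. *)

Set Implicit Arguments.
Unset Strict Implicit.
Unset Printing Implicit Defensive.

Import Order.TTheory GRing.Theory Num.Theory.
Import numFieldNormedType.Exports.

Local Open Scope classical_set_scope.
Local Open Scope ring_scope.

(** * Cauchy estimates for polynomials *)

Lemma exists_prim_root (C : numClosedFieldType) (N : nat) :
  (0 < N)%N -> exists w : C, N.-primitive_root w.
Proof.
move=> N0; have [rs Drs] := closed_field_poly_normal ('X^N - 1 : {poly C}).
rewrite (monicP (monicXnsubC _ N0)) scale1r in Drs.
have szrs : (N <= size rs)%N.
  by rewrite -ltnS -(size_prod_XsubC rs id) -Drs size_XnsubC.
have rsP : all N.-unity_root rs.
  by apply/allP => x xrs; rewrite /root_of_unity Drs root_prod_XsubC.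
have urs : uniq rs.
  by rewrite -separable.separable_prod_XsubC -Drs
    cyclotomic.separable_Xn_sub_1 // pnatr_eq0 -lt0n.
by have /hasP[w _ ?] := cyclic.has_prim_root N0 rsP urs szrs; exists w.
Qed.

(** Cauchy's estimate, with the integral over the circle replaced by the mean
    over the N-th roots of unity: for N larger than the degree this mean is
    exact, so it extracts a single coefficient. *)
Lemma cauchy_coef_bound (C : numClosedFieldType) (p : {poly C}) (rho M : C) :
  0 <= rho -> (forall z, `|z| <= rho -> `|p.[z]| <= M) ->
  forall j, `|p`_j| * rho ^+ j <= M.
Proof.
move=> rho0 pM j.
(* N exceeds both the degree of p and j, so that among the powers of w below
   only the one of index j sums to something nonzero. *)
pose N := maxn (size p) j.+1.
have jN : (j < N)%N by rewrite leq_max ltnSn orbT.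
have N0 : (0 < N)%N by apply: leq_ltn_trans jN.
have [w wP] := exists_prim_root C N0.
have w1 : `|w| = 1.
  apply/eqP; rewrite -(@pexpr_eq1 _ _ N) // -normrX.
  by rewrite (prim_expr_order wP) normr1.
have pE x : p.[x] = \sum_(i < N) p`_i * x ^+ i.
  by apply: horner_coef_wide; exact: leq_maxl.
(* The exponent N - j stands for -j, as w has order N. *)
have key : \sum_(k < N) p.[rho * w ^+ k] * w ^+ (k * (N - j)) =
   (p`_j * rho ^+ j) *+ N.
  transitivity (\sum_(k < N) \sum_(i < N)
      p`_i * rho ^+ i * (w ^+ (i + (N - j))) ^+ k).
    apply: eq_bigr => k _; rewrite pE mulr_suml; apply: eq_bigr => i _.
    rewrite exprMn -!exprM mulrA -mulrA -exprD; congr (_ * w ^+ _).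
    by rewrite mulnDl (mulnC k) (mulnC k).
  rewrite exchange_big /= (bigD1 (Ordinal jN)) //= [X in _ + X]big1 ?addr0.
    rewrite -mulr_sumr subnKC ?(ltnW jN) // (prim_expr_order wP).
    under eq_bigr do rewrite expr1n.
    by rewrite sumr_const card_ord mulr_natr.
  move=> i ij; rewrite -mulr_sumr; apply/eqP; rewrite mulf_eq0; apply/orP; right.
  set x := w ^+ _.
  have x1 : x != 1.
    rewrite -(prim_order_dvd wP); apply/negP => dv.
    have iN := ltn_ord i.
    have {}ij : nat_of_ord i <> j.
      by move=> e; move/eqP: ij; apply; apply: val_inj.
    have [ij'|ij'] := ltnP i j; first by have := dvdn_leq _ dv; lia.
    move: dv; have -> : (i + (N - j) = N + (i - j))%N by lia.
    by rewrite dvdn_addr // => /dvdn_leq; lia.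
  have := subrX1 x N; rewrite {1}/x -exprM mulnC exprM (prim_expr_order wP).
  by rewrite expr1n subrr => /esym/eqP; rewrite mulf_eq0 subr_eq0 (negbTE x1).
have : `|(p`_j * rho ^+ j) *+ N| <= M *+ N.
  rewrite -key (le_trans (ler_norm_sum _ _ _)) //.
  apply: (@le_trans _ _ (\sum_(k < N) M)); last by rewrite sumr_const card_ord.
  apply: ler_sum => k _; rewrite normrM normrX w1 expr1n mulr1.
  by apply: pM; rewrite normrM normrX w1 expr1n mulr1 ger0_norm.
by rewrite normrMn ler_pMn2r // normrM normrX (ger0_norm rho0).
Qed.

(** Cauchy's estimate makes the tail of the expansion at 0 a geometric series of
    ratio at most 1/2. The bound depends on p only through M, which is what
    lets it pass to uniform limits. *)
Lemma taylor1_bound (C : numClosedFieldType) (p : {poly C}) (rho M : C) :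
  0 < rho -> (forall z, `|z| <= rho -> `|p.[z]| <= M) ->
  forall z, `|z| *+ 2 <= rho ->
  `|p.[z] - p`_0 - p`_1 * z| <= M *+ 2 * (`|z| / rho) ^+ 2.
Proof.
move=> rho0 pM z zr; set t := `|z| / rho.
have t0 : 0 <= t by rewrite divr_ge0 // ltW.
have t2 : t *+ 2 <= 1 by rewrite /t -mulrnAl ler_pdivrMr // mul1r.
have M0 : 0 <= M by apply: le_trans (pM 0 _); rewrite ?normr0 // ltW.
have cb i : `|p`_i * z ^+ i| <= M * t ^+ i.
  rewrite normrM normrX /t expr_div_n mulrA ler_pdivlMr ?exprn_gt0 // mulrAC.
  by rewrite ler_wpM2r ?exprn_ge0 //; apply: cauchy_coef_bound => //; exact: ltW.
have -> : p.[z] - p`_0 - p`_1 * z = \sum_(i < size p) p`_(2 + i) * z ^+ (2 + i).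
  rewrite (@horner_coef_wide _ (2 + size p)) ?leq_addl //.
  by rewrite big_split_ord /= !big_ord_recl big_ord0 /=; ring.
rewrite (le_trans (ler_norm_sum _ _ _)) //.
apply: (@le_trans _ _ (\sum_(i < size p) M * t ^+ 2 * t ^+ i)).
  by apply: ler_sum => i _; rewrite -mulrA -exprD.
rewrite -mulr_sumr; set S := \sum_(i < _) _.
have S0 : 0 <= S by apply: sumr_ge0 => i _; exact: exprn_ge0.
suff S2 : S <= 2%:R.
  have -> : M *+ 2 * t ^+ 2 = M * t ^+ 2 * 2%:R by ring.
  by apply: ler_wpM2l => //; rewrite mulr_ge0 // exprn_ge0.
have h : (1 - t) * S <= 1.
  have -> : (1 - t) * S = 1 - t ^+ size p.
    by rewrite -[RHS]opprB subrX1 -/S; ring.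
  by rewrite gerBl exprn_ge0.
have t1 : 1 <= (1 - t) *+ 2 by rewrite mulrnBl lerBrDr mulr2n lerD2l.
have := ler_wpM2r S0 t1; rewrite mul1r mulrnAl => /le_trans; apply.
by rewrite -[2%:R]/(1 *+ 2) lerMn2r h.
Qed.

(** * Polynomial approximation on discs *)

Lemma exists_expr_le (R : realType) (t e : R[i]) :
  0 <= t -> t < 1 -> 0 < e -> exists N, t ^+ N <= e.
Proof.
move=> t0 t1 e0.
have tE : t = (complex.Re t)%:C%C by rewrite RRe_real // ger0_real.
have eE : e = (complex.Re e)%:C%C by rewrite RRe_real // gtr0_real.
move: t0 t1 e0; rewrite tE eE -[0]/(0%:C%C) -[1]/(1%:C%C) lecR !ltcR => t0 t1 e0.
have : `|complex.Re t| < 1 by rewrite ger0_norm.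
move=> /cvg_expr /cvgrPdist_le /(_ _ e0)[N _ /(_ N (leqnn N))] /=.
rewrite sub0r normrN ger0_norm ?exprn_ge0 // => h.
by exists N; rewrite -rmorphXn lecR.
Qed.

Section Approx.
Variable R : realType.
Local Notation C := R[i].
Implicit Types (p q s : {poly C}) (rho e : C) (f : C -> C).

(** Uniform limits of polynomials on a closed disc around 0. This class takes
    the place of power series: it contains the rational functions without poles
    in the disc, is closed under uniform limits, and its members are
    differentiable at 0. *)
Definition disc_approximable rho f : Prop :=
  forall e, 0 < e -> exists p, forall h, `|h| <= rho -> `|f h - p.[h]| <= e.

Lemma poly_bounded p rho : 0 <= rho ->
  exists2 B, 0 <= B & forall h, `|h| <= rho -> `|p.[h]| <= B.
Proof.
move=> rho0; exists (\sum_(i < size p) `|p`_i| * rho ^+ i).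
  by apply: sumr_ge0 => i _; rewrite mulr_ge0 // exprn_ge0.
move=> h hr; rewrite horner_coef (le_trans (ler_norm_sum _ _ _)) //.
apply: ler_sum => i _; rewrite normrM normrX ler_wpM2l // lerXn2r //.
Qed.

(** A polynomial inverse of X - a up to a small error: 1 - (X / a)^N vanishes at
    a, so it is (X - a) s, and the error (h / a)^N is small on the disc. *)
Lemma XsubC_inv_approx a rho e : 0 <= rho -> rho < `|a| -> 0 < e ->
  exists s, forall h, `|h| <= rho -> `|1 - (h - a) * s.[h]| <= e.
Proof.
move=> rho0 ra e0; have a0 : 0 < `|a| by apply: le_lt_trans ra.
have an0 : a != 0 by rewrite -normr_gt0.
have [||N Ne] := @exists_expr_le R (rho / `|a|) e _ _ e0.
- by rewrite divr_ge0.
- by rewrite ltr_pdivrMr ?mul1r.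
have /factor_theorem[s sE] : root (1 - (a^-1 *: 'X) ^+ N) a.
  by rewrite /root !hornerE /= mulVf // expr1n subrr.
exists s => h hr.
have -> : (h - a) * s.[h] = 1 - (h / a) ^+ N.
  have : (1 - (a^-1 *: 'X) ^+ N).[h] = s.[h] * (h - a).
    by rewrite sE hornerM hornerXsubC.
  by rewrite !hornerE /= => eN; rewrite mulrC -eN (mulrC a^-1).
rewrite subKr normrX normf_div (le_trans _ Ne) // lerXn2r ?nnegrE ?divr_ge0 //.
by rewrite ler_pM2r ?invr_gt0.
Qed.

(** Approximate inverses multiply: if 1 - q1 s1 and 1 - q2 s2 are small then so
    is 1 - q1 q2 s1 s2. Splitting q into linear factors reduces to X - a. *)
Lemma inv_approx q rho : 0 <= rho -> (forall h, `|h| <= rho -> q.[h] != 0) ->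
  forall e, 0 < e ->
  exists s, forall h, `|h| <= rho -> `|1 - q.[h] * s.[h]| <= e.
Proof.
move=> rho0 q0.
have [rs qE] := closed_field_poly_normal q.
have lq0 : lead_coef q != 0.
  rewrite lead_coef_eq0; apply/eqP => qz; move: (q0 0); rewrite qz normr0 rho0.
  by rewrite horner0 eqxx => /(_ isT).
have rsP : {in rs, forall a, rho < `|a|}.
  move=> a ars; rewrite real_ltNge ?ger0_real //; apply/negP => /q0.
  by rewrite qE hornerZ mulf_eq0 negb_or -/(root _ _) root_prod_XsubC ars andbF.
suff key : forall e, 0 < e -> exists s, forall h, `|h| <= rho ->
    `|1 - (\prod_(a <- rs) ('X - a%:P)).[h] * s.[h]| <= e.
  move=> e /key[s sP]; exists ((lead_coef q)^-1 *: s) => h /sP.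
  by rewrite qE !hornerZ lead_coefZ (monicP (monic_prod_XsubC _ _ _)) mulr1
    mulrACA mulfV // mul1r.
elim: rs rsP {qE} => [|a rs IH] rsP e e0.
  by exists 1 => h _; rewrite big_nil !hornerE subrr normr0 ltW.
have e20 : 0 < e / 2 by rewrite divr_gt0.
have e10 : 0 < 1 + e / 2 by rewrite addr_gt0.
have [|s1 s1P] := @XsubC_inv_approx a rho _ rho0 _ e20.
  by apply: rsP; rewrite mem_head.
have [||s2 s2P] := IH _ (e / 2 / (1 + e / 2)).
- by move=> b brs; apply: rsP; rewrite inE brs orbT.
- by rewrite divr_gt0.
exists (s1 * s2) => h hr; rewrite big_cons !hornerM hornerXsubC.
set q1 := h - a; set q2 := (\prod_(_ <- _) _).[h].
have -> : 1 - q1 * q2 * (s1.[h] * s2.[h]) =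
  (1 - q1 * s1.[h]) + q1 * s1.[h] * (1 - q2 * s2.[h]) by ring.
have h1 : `|1 - q1 * s1.[h]| <= e / 2 by exact: s1P.
have h2 : `|q1 * s1.[h]| <= 1 + e / 2.
  have -> : q1 * s1.[h] = 1 - (1 - q1 * s1.[h]) by ring.
  by rewrite (le_trans (ler_normB _ _)) // normr1 lerD2l.
rewrite (splitr e) (le_trans (ler_normD _ _)) // lerD // normrM.
rewrite (le_trans (ler_pM _ _ h2 (s2P _ hr))) //.
by rewrite mulrC divfK // gt_eqF.
Qed.

Lemma rat_disc_approximable p q rho :
  0 <= rho -> (forall h, `|h| <= rho -> q.[h] != 0) ->
  disc_approximable rho (fun h => p.[h] / q.[h]).
Proof.
move=> rho0 q0 e e0.
(* A first, crude approximate inverse s0 only serves to bound p / q. *)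
have [|s0 s0P] := @inv_approx q rho rho0 q0 (1 / 2); first by rewrite divr_gt0.
have [B B0 BP] := poly_bounded (p * s0) rho0.
have [|s sP] := @inv_approx q rho rho0 q0 (e / (B * 2 + 1)).
  by rewrite divr_gt0 // ltr_wpDl // mulr_ge0.
exists (p * s) => h hr; rewrite hornerM.
have qh0 := q0 _ hr.
have -> : p.[h] / q.[h] - p.[h] * s.[h] =
  p.[h] / q.[h] * (1 - q.[h] * s.[h]) by field.
have pq : `|p.[h] / q.[h]| <= B * 2 + 1.
  have h1 : 1 <= `|q.[h] * s0.[h]| * 2.
    rewrite -ler_pdivrMr //; have := s0P _ hr.
    have := ler_distD (q.[h] * s0.[h]) 1 0; rewrite !subr0 normr1 => h1 h2.
    have := le_trans h1 (lerD h2 (lexx _)).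
    by rewrite -lerBlDl; congr (_ <= _); field.
  rewrite (@le_trans _ _ (`|(p * s0).[h]| * 2)) //; last first.
    rewrite (@le_trans _ _ (B * 2)) ?lerDl //.
    by rewrite ler_wpM2r // BP.
  rewrite hornerM !normrM -mulrA ler_wpM2l // normfV.
  rewrite -[leLHS]mulr1 (le_trans (ler_wpM2l _ h1)) ?invr_ge0 //.
  by rewrite normrM !mulrA mulVf ?mul1r // normr_eq0.
rewrite normrM (le_trans (ler_pM _ _ pq (sP _ hr))) //.
by rewrite mulrC divfK // gt_eqF // ltr_wpDl // mulr_ge0.
Qed.

Lemma unif_disc_approximable f rho :
  (forall e, 0 < e -> exists2 g, disc_approximable rho g &
      forall h, `|h| <= rho -> `|f h - g h| <= e) ->
  disc_approximable rho f.
Proof.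
move=> H e e0; have e20 : 0 < e / 2 by rewrite divr_gt0.
have [g /(_ _ e20)[p pP] gP] := H _ e20.
exists p => h hr; rewrite (splitr e) (le_trans (ler_distD (g h) _ _)) // lerD //.
  exact: gP.
exact: pP.
Qed.

End Approx.

(** * Differentiability of uniform limits of polynomials *)

(** Pairwise intersecting compact intervals have a common point. Used with
    approximations of precision u i, it produces their limit without ordering
    them into a sequence. *)
Lemma real_interval_center (R : realType) (I : Type) (i0 : I) (c u : I -> R) :
  (forall i j, `|c i - c j| <= u i + u j) ->
  exists c0, forall i, `|c i - c0| <= u i.
Proof.
move=> cu; pose E := [set c i - u i | i in [set: I]].
have ub j : ubound E (c j + u j).
  move=> _ [i _ <-]; have := cu i j; rewrite ler_norml => /andP[_].
  by rewrite lerBlDr lerBlDr; lra.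
have supE : has_sup E.
  by split; [exists (c i0 - u i0), i0 | exists (c i0 + u i0); exact: ub].
exists (sup E) => i.
have h1 : c i - u i <= sup E by apply: sup_upper_bound => //; exists i.
have h2 : sup E <= c i + u i by apply: ge_sup; [case: supE | exact: ub].
by rewrite ler_norml; apply/andP; split; lra.
Qed.

Section Holo.
Variable R : realType.
Local Notation C := (R[i]^o).

Lemma normc_i : `|'i%C| = 1 :> R[i].
Proof. by rewrite normc_def /= expr0n expr1n add0r sqrtr1. Qed.

Lemma Re_normc2 (x : R[i]) : (complex.Re (`|x| ^+ 2))%:C%C = `|x| ^+ 2.
Proof. by rewrite RRe_real // ger0_real // exprn_ge0. Qed.

Lemma normc_real (x : R) : `|x%:C%C| = `|x|%:C%C.
Proof. by rewrite normc_def /= expr0n addr0 sqrtr_sqr. Qed.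

Lemma realcD (x y : R) : (x + y)%:C%C = x%:C%C + y%:C%C.
Proof. exact: rmorphD. Qed.

Lemma realcM (x y : R) : (x * y)%:C%C = x%:C%C * y%:C%C.
Proof. exact: rmorphM. Qed.

Lemma realcV (x : R) : x^-1%:C%C = x%:C%C^-1.
Proof. exact: fmorphV. Qed.

Lemma complex_interval_center (I : Type) (i0 : I) (c : I -> R[i]) (u : I -> R) :
  (forall i j, `|c i - c j| <= (u i + u j)%:C%C) ->
  exists c0, forall i, `|c i - c0| <= (u i *+ 2)%:C%C.
Proof.
move=> cu.
have [a aP] : exists a, forall i, `|complex.Re (c i) - a| <= u i.
  apply: (real_interval_center i0) => i j; rewrite -lecR.
  by apply: le_trans (cu i j); rewrite -raddfB; exact: normc_ge_Re.
have [b bP] : exists b, forall i, `|complex.Im (c i) - b| <= u i.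
  apply: (real_interval_center i0) => i j; rewrite -lecR.
  apply: le_trans (cu i j); rewrite -raddfB -normrN -ReiNIm.
  by apply: le_trans (normc_ge_Re _) _; rewrite normrM normc_i mulr1.
exists (a +i* b)%C => i.
have -> : c i - (a +i* b)%C =
   (complex.Re (c i) - a)%:C%C + 'i%C * (complex.Im (c i) - b)%:C%C.
  by rewrite [LHS]complexE !raddfB.
rewrite (le_trans (ler_normD _ _)) // mulr2n (realcD (u i)) lerD //.
  by rewrite normc_real lecR.
by rewrite normrM normc_i mul1r normc_real lecR.
Qed.

(** The linear coefficients of polynomials approximating f determine each other up
    to the precision of the approximation, by Cauchy's estimate on the
    difference; so they converge, and the Taylor bound passes to f. *)
Lemma disc_approximable_taylor (f : C -> C) (r : R) :
  0 < r -> disc_approximable r%:C%C f ->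
  exists (c M : C), 0 <= M /\
    forall h, `|h| *+ 2 <= r%:C%C -> `|f h - f 0 - c * h| <= M * `|h| ^+ 2.
Proof.
move=> r0 fP; set rho := r%:C%C.
have rho0 : 0 < rho by rewrite ltcR.
(* The polynomial approximations of f on the disc, with their precision. *)
pose I := {ep : R * {poly R[i]} | 0 < ep.1 /\
  forall h, `|h| <= rho -> `|f h - ep.2.[h]| <= ep.1%:C%C}.
have IP e : 0 < e -> exists i : I, (sval i).1 = e.
  move=> e0; have [|p pP] := fP e%:C%C; first by rewrite ltcR.
  by exists (exist _ (e, p) (conj e0 pP)).
have [i0 _] := IP 1 ltr01.
pose p (i : I) := (sval i).2; pose e (i : I) := (sval i).1.
have pe i h : `|h| <= rho -> `|f h - (p i).[h]| <= (e i)%:C%C.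
  by move=> hr; case: i => -[e' p'] [? ?] /=; auto.
have [c cP] : exists c, forall i, `|(p i)`_1 - c| <= (e i / r *+ 2)%:C%C.
  apply: (complex_interval_center i0) => i j.
  have := @cauchy_coef_bound _ (p i - p j) rho (e i + e j)%:C%C (ltW rho0) _ 1%N.
  rewrite coefB expr1 -mulrDl realcM fmorphV ler_pdivlMr //.
  apply=> h hr; rewrite hornerD hornerN realcD addrC.
  have -> : - (p j).[h] + (p i).[h] = (f h - (p j).[h]) - (f h - (p i).[h]).
    by ring.
  by rewrite [leRHS]addrC (le_trans (ler_normB _ _)) // lerD // pe.
(* All approximations of precision at most 1 are bounded by M on the disc. *)
have [B B0 BP] := poly_bounded (p i0) (ltW rho0).
pose M := B + (e i0)%:C%C + (1 : R)%:C%C.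
have ei0 : 0 <= (e i0)%:C%C by apply: le_trans (pe i0 0 _); rewrite ?normr0 // ltW.
exists c, (M *+ 2 / rho ^+ 2).
have M0 : 0 <= M by rewrite !addr_ge0 // ler0c ler01.
split; first by rewrite divr_ge0 ?mulrn_wge0 // exprn_ge0 // ltW.
move=> h hr.
have hr' : `|h| <= rho by apply: le_trans hr; rewrite mulr2n lerDl.
apply/ler_addgt0Pr => d d0.
have dE : d = (complex.Re d)%:C%C by rewrite RRe_real // gtr0_real.
(* Besides the Taylor remainder, the error of the approximation i is e i * K. *)
pose K := 2 + 2 * complex.Re `|h| / r.
have hE : `|h| = (complex.Re `|h|)%:C%C by rewrite RRe_real // ger0_real.
have hR0 : 0 <= complex.Re `|h| by rewrite -ler0c -hE.
have K0 : 0 < K by rewrite /K ltr_pwDl // divr_ge0 ?mulr_ge0 // ltW.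
have dR0 : 0 < complex.Re d by rewrite -ltcR -dE.
have [|i eiE] := IP (Num.min 1 (complex.Re d / K)).
  by rewrite lt_min ltr01 divr_gt0.
have ei1 : e i <= 1 by rewrite /e eiE ge_min lexx.
have eid : e i * K <= complex.Re d.
  by rewrite -ler_pdivlMr // /e eiE ge_min lexx orbT.
have pM x : `|x| <= rho -> `|(p i).[x]| <= M.
  move=> xr; have -> : (p i).[x] = (p i0).[x] + (f x - (p i0).[x]) - (f x - (p i).[x]).
    by ring.
  rewrite (le_trans (ler_normB _ _)) // lerD //.
    rewrite (le_trans (ler_normD _ _)) // lerD ?pe ?BP //.
  by rewrite (le_trans (pe _ _ xr)) // lecR.
have T := taylor1_bound rho0 pM hr.
have h00 : `|0 : C| <= rho by rewrite normr0 ltW.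
have -> : f h - f 0 - c * h = ((p i).[h] - (p i)`_0 - (p i)`_1 * h) +
   ((f h - (p i).[h]) - (f 0 - (p i).[0]) + ((p i)`_1 - c) * h).
  by rewrite horner_coef0; ring.
rewrite (le_trans (ler_normD _ _)) // lerD //.
  by rewrite (le_trans T) // expr_div_n mulrA mulrAC lexx.
have Kd : (e i * K)%:C%C <= d by rewrite dE lecR.
rewrite (le_trans _ Kd) // (le_trans (ler_normD _ _)) //.
have -> : e i * K = (e i + e i) + (e i / r *+ 2) * complex.Re `|h|.
  by rewrite /K; field; exact: lt0r_neq0.
rewrite realcD (realcD (e i)) realcM -hE lerD //.
  by rewrite (le_trans (ler_normB _ _)) // lerD // pe.
by rewrite normrM ler_wpM2r.
Qed.

Lemma disc_approximable_derivable (f : C -> C) (b : C) (r : R) :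
  0 < r -> disc_approximable r%:C%C (fun h => f (h + b)) -> derivable f b 1.
Proof.
move=> r0 /(disc_approximable_taylor r0)[c [M [M0 cP]]].
apply/cvg_ex; exists c; apply/cvgrPdist_le => e e0.
have M10 : 0 < M + 1 by rewrite ltr_wpDl.
near=> h.
have h0 : h != 0 by near: h; exact: nbhs_dnbhs_neq.
have hr : `|h| *+ 2 <= r%:C%C.
  rewrite -mulr_natr -ler_pdivlMr //; near: h; apply: dnbhs0_le.
  by rewrite divr_gt0 // ltcR.
have he : `|h| <= e / (M + 1) by near: h; apply: dnbhs0_le; rewrite divr_gt0.
have := cP _ hr; rewrite add0r /= => ch.
have -> : c - h^-1 *: (f (h *: 1 + b) - f b) =
    - (h^-1 * (f (h + b) - f b - c * h)).
  rewrite /GRing.scale /= mulr1; field.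
  exact: h0.
rewrite normrN normrM normfV ler_pdivrMl ?normr_gt0 //.
rewrite (le_trans ch) // expr2 mulrCA ler_wpM2l //.
rewrite (le_trans (ler_wpM2l M0 he)) // mulrCA -[leRHS]mulr1 (ler_wpM2l (ltW e0)) //.
by rewrite ler_pdivrMr // mul1r lerDl ler01.
Unshelve. all: by end_near. Qed.

Variable Om : set C.

Lemma rat_approxP (r : nat -> {poly R[i]} * {poly R[i]}) f :
  rat_approx Om r f -> forall e : R[i], 0 < e ->
  \forall k \near \oo, forall z, Om z -> `|f z - rat_eval (r k) z| < e.
Proof.
move=> [_ rf] e e0.
have /rf : nbhs (f : {uniform` Om -> C}) [set g | forall z, Om z -> `|f z - g z| < e].
  apply/uniform_nbhs; exists [set xy : C * C | ball xy.1 e xy.2].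
  by split; [exact: (entourage_ball _ (PosNum e0)) | move=> g gP z /gP; rewrite /= -ball_normE].
by [].
Qed.

Lemma algebraA_approx f : algebraA Om f -> forall e : R[i], 0 < e ->
  exists2 r, poles_off_closure Om r &
    forall z, Om z -> `|f z - rat_eval r z| <= e.
Proof.
move=> [r rf] e e0; have [N _ /(_ N (leqnn N)) rN] := rat_approxP rf e0.
exists (r N); first by case: rf.
by move=> z /rN /ltW.
Qed.

(** Weierstrass' theorem for members of the algebra: near a point of Om they are
    uniform limits of polynomials. *)
Lemma algebraA_holomorphic f : open Om -> algebraA Om f -> holomorphic_on Om f.
Proof.
move=> oOm fA b Omb.
have /nbhs_ballP[e /= e0 beOm] : nbhs b Om by exact: open_nbhs_nbhs.
have eE : e = (complex.Re e)%:C%C by rewrite RRe_real // gtr0_real.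
have e20 : 0 < complex.Re e / 2 by rewrite divr_gt0 // -ltcR -eE.
have inOm h : `|h| <= (complex.Re e / 2)%:C%C -> Om (h + b).
  move=> hr; apply: beOm; rewrite -ball_normE /= opprD addrCA subrr addr0 normrN.
  by rewrite (le_lt_trans hr) // eE ltcR /= ltr_pdivrMr // ltr_pMr ?ltr1n // -ltcR -eE.
apply: (disc_approximable_derivable e20).
apply: unif_disc_approximable => d d0.
have [[p q] pq rP] := algebraA_approx fA d0.
exists (fun h => rat_eval (p, q) (h + b)); last by move=> h /inOm /rP.
have comE s h : s.[h + b] = (s \Po ('X + b%:P)).[h].
  by rewrite horner_comp !hornerE.
have := @rat_disc_approximable _ (p \Po ('X + b%:P)) (q \Po ('X + b%:P))
  (complex.Re e / 2)%:C%C.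
rewrite lecR ltW // => /(_ isT) H.
have {}H := H _; rewrite /rat_eval /=; under eq_fun do rewrite !comE; apply: H.
move=> h /inOm hOm; rewrite -comE; apply: pq => /=.
exact: subset_closure.
Qed.

End Holo.

(** * Bounds on the domain, and harmonic functions *)

Section Bounded.
Variable R : realType.
Local Notation C := (R[i]^o).
Variable Om : set C.

(** Each root of q has a ball around it that misses Om. *)
Lemma norm_poly_lower_bound (q : {poly R[i]}) :
  (forall z : C, closure Om z -> q.[z] != 0) -> q != 0 ->
  exists2 e : R[i], 0 < e & forall z, Om z -> e <= `|q.[z]|.
Proof.
move=> q0 qn0; have [rs qE] := closed_field_poly_normal q.
have lq0 : lead_coef q != 0 by rewrite lead_coef_eq0.
have rsP : {in rs, forall a : R[i], ~ closure Om a}.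
  move=> a ars /q0; rewrite qE hornerZ mulf_eq0 negb_or -/(root _ _).
  by rewrite root_prod_XsubC ars andbF.
suff [e e0 eP] : exists2 e : R[i], 0 < e &
    forall z, Om z -> e <= `|(\prod_(a <- rs) ('X - a%:P)).[z]|.
  exists (`|lead_coef q| * e); first by rewrite mulr_gt0 ?normr_gt0.
  by move=> z /eP; rewrite qE hornerZ lead_coefZ (monicP (monic_prod_XsubC _ _ _))
    mulr1 normrM ler_pM2l // normr_gt0.
elim: rs rsP {qE} => [|a rs IH] rsP.
  by exists 1 => // z _; rewrite big_nil hornerC normr1.
have [|e2 e20 e2P] := IH; first by move=> b brs; apply: rsP; rewrite inE brs orbT.
have := rsP a (mem_head _ _); rewrite /closure /= => /existsNP[B /not_implyP[]].
move=> /nbhs_ballP[e1 /= e10 e1B] BOm.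
exists (e1 * e2); first exact: mulr_gt0.
move=> z Omz; rewrite big_cons hornerM hornerXsubC normrM (ler_pM (ltW e10) (ltW e20)) ?e2P //.
rewrite real_leNgt ?(gtr0_real e10) // ?normr_real //.
apply/negP => h; apply: BOm; exists z; split => //; apply: e1B.
by rewrite -ball_normE /= distrC.
Qed.

Lemma algebraA_bounded (f : C -> C) :
  Om !=set0 -> bounded_set Om -> algebraA Om f ->
  exists2 B : R, 0 <= B & forall z, Om z -> `|f z| <= B%:C%C.
Proof.
move=> [z0 Omz0] [M [Mreal MP]] fA.
have [rho rho0 Omrho] : exists2 rho : R[i], 0 <= rho & forall z, Om z -> `|z| <= rho.
  exists (`|M| + 1); first by rewrite addr_ge0.
  by apply: MP; rewrite (le_lt_trans (real_ler_norm _)) // ltrDl ltr01.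
have [[p q] pq rP] := algebraA_approx fA (@ltr01 R[i]).
have [|e e0 eP] := norm_poly_lower_bound pq.
  by apply/eqP => /= qz; have := pq _ (subset_closure Omz0); rewrite /= qz horner0 eqxx.
have [B B0 BP] := poly_bounded p rho0.
have D0 : 0 <= 1 + B / e by rewrite addr_ge0 // divr_ge0 // ltW.
have DE : 1 + B / e = (complex.Re (1 + B / e))%:C%C.
  by rewrite RRe_real // ger0_real.
exists (complex.Re (1 + B / e)); first by rewrite -ler0c -DE.
rewrite -DE => z Omz.
have -> : f z = (f z - rat_eval (p, q) z) + rat_eval (p, q) z by rewrite subrK.
rewrite (le_trans (ler_normD _ _)) // lerD ?rP // normf_div.
have qz0 : 0 < `|q.[z]| by apply: lt_le_trans e0 (eP _ Omz).
by rewrite ler_pM ?invr_ge0 ?BP ?Omrho // lef_pV2 ?posrE // eP.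
Qed.

End Bounded.

(** * Harmonic functions *)

Section Harmonic.
Variable R : realType.
Local Notation C := (R[i]^o).
Variable U : set C.

Lemma nbhs_complex_pair (p : R * R) (A : set C) : nbhs (p.1 +i* p.2 : C)%C A ->
  \forall p' \near p, A (p'.1 +i* p'.2)%C.
Proof.
move=> /nbhs_ballP[e /= e0 eA].
have eE : e = (complex.Re e)%:C%C by rewrite RRe_real // gtr0_real.
have e20 : 0 < complex.Re e / 2 by rewrite divr_gt0 // -ltcR -eE.
apply/nbhs_ballP; exists (complex.Re e / 2) => // p' [/= h1 h2]; apply: eA.
move: h1 h2; rewrite -!ball_normE /= => h1 h2.
have -> : (p.1 +i* p.2 - p'.1 +i* p'.2)%C =
   (p.1 - p'.1)%:C%C + 'i%C * (p.2 - p'.2)%:C%C by rewrite [LHS]complexE.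
rewrite (le_lt_trans (ler_normD _ _)) // normrM normc_i mul1r !normc_real.
by rewrite -realcD eE ltcR (splitr (complex.Re e)) ltrD.
Qed.

Lemma continuous_lin (a b : R) (f g : R * R -> R) (p : R * R) :
  {for p, continuous f} -> {for p, continuous g} ->
  {for p, continuous (fun q => a * f q + b * g q)}.
Proof. by move=> cf cg; apply: cvgD; apply: cvgMr. Qed.

Lemma harmonic_lin (a b : R) (u v : C -> R) : open U ->
  harmonic_on U u -> harmonic_on U v ->
  harmonic_on U (fun z => a * u z + b * v z).
Proof.
move=> oU hu hv.
pose f (p : R * R) := u (p.1 +i* p.2)%C; pose g (p : R * R) := v (p.1 +i* p.2)%C.
pose axis : set (R * R) := [set (1, 0); (0, 1)].
pose U2 : set (R * R) := [set p | U (p.1 +i* p.2)%C].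
have x1 : axis (1, 0) by left.
have y1 : axis (0, 1) by right.
have lin0 (A B A' B' : R) : A + B = 0 -> A' + B' = 0 ->
    (a * A + b * A') + (a * B + b * B') = 0.
  by move=> e1 e2; rewrite addrACA -!mulrDr e1 e2 !mulr0 addr0.
have nU p : U2 p -> \forall p' \near p, U2 p'.
  by move=> Up; apply: nbhs_complex_pair; exact: open_nbhs_nbhs.
have D1 d p : axis d -> U2 p -> derivable f p d /\ derivable g p d.
  by move=> dx Up; have [+ _] := hu p Up; have [+ _] := hv p Up; split; auto.
have E1 d p : axis d -> U2 p ->
    'D_d (a *: f + b *: g) p = (a *: 'D_d f + b *: 'D_d g) p.
  move=> dx Up; have [df dg] := D1 _ _ dx Up.
  by rewrite (deriveD (derivableZ df) (derivableZ dg)) (deriveZ _ df) (deriveZ _ dg).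
have N1 d p : axis d -> U2 p -> {near p, a *: 'D_d f + b *: 'D_d g =1
    'D_d (a *: f + b *: g)}.
  by move=> dx /nU; apply: filterS => p' Up'; rewrite E1.
have D2 d e p : axis d -> axis e -> U2 p ->
    derivable ('D_d f) p e /\ derivable ('D_d g) p e.
  move=> dx ex Up; have [_ [+ _]] := hu p Up; have [_ [+ _]] := hv p Up.
  move=> /(_ d e dx ex)[dg _] /(_ d e dx ex)[df _].
  by split; [exact: df|exact: dg].
have E2 d e p : axis d -> axis e -> U2 p ->
    'D_e ('D_d (a *: f + b *: g)) p =
    a * 'D_e ('D_d f) p + b * 'D_e ('D_d g) p.
  move=> dx ex Up; have [df dg] := D2 _ _ _ dx ex Up.
  rewrite -(near_eq_derive _ (N1 d p dx Up)).
  by rewrite (deriveD (derivableZ df) (derivableZ dg)) (deriveZ _ df) (deriveZ _ dg).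
move=> p Up.
rewrite -[fun p0 : R * R => _]/(a *: f + b *: g) -/axis; split => [d dx|].
  by have [df dg] := D1 _ _ dx Up; exact: derivableD (derivableZ df) (derivableZ dg).
split=> [d e dx ex|].
  split.
    apply: near_eq_derivable (N1 d p dx Up) _.
    have [df dg] := D2 _ _ _ dx ex Up.
    exact: derivableD (derivableZ df) (derivableZ dg).
  have cfg : {for p, continuous (fun p => a * 'D_e ('D_d f) p + b * 'D_e ('D_d g) p)}.
    have [_ [+ _]] := hu p Up; have [_ [+ _]] := hv p Up.
    move=> /(_ d e dx ex)[_ cg] /(_ d e dx ex)[_ cf].
    exact: continuous_lin cf cg.
  rewrite /prop_for /continuous_at E2 //.
  apply: cvg_trans cfg; apply: near_eq_cvg.
  by near=> p'; rewrite E2 //; near: p'; exact: nU.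
have [_ [_ lu]] := hu p Up; have [_ [_ lv]] := hv p Up.
rewrite (E2 _ _ _ x1 x1 Up) (E2 _ _ _ y1 y1 Up); exact: lin0 lu lv.
Unshelve. all: by end_near. Qed.

Lemma harmonic_scale (a : R) (u : C -> R) : open U ->
  harmonic_on U u -> harmonic_on U (fun z => a * u z).
Proof.
move=> oU hu; rewrite (_ : (fun z => _) = fun z => a * u z + 0 * u z).
  exact: harmonic_lin.
by apply/funext => z; rewrite mul0r addr0.
Qed.

Lemma harmonic0 : harmonic_on U (fun=> 0).
Proof.
have d0 d : 'D_d (cst 0 : R * R -> R) = cst 0.
  by apply/funext => q; exact: derive_cst.
move=> p _; rewrite -[fun _ : R * R => _]/(cst 0 : R * R -> R).
split; first by move=> d _; exact: derivable_cst.
split; last by rewrite !d0 !derive_cst addr0.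
move=> d e _ _; rewrite !d0.
by split; [exact: derivable_cst|exact: cst_continuous].
Qed.

End Harmonic.

(** * The space H2 *)

Section HardySpace.
Variable R : realType.
Local Notation C := (R[i]^o).
Variables (Om : set C) (t0 : C) (m : nat) (hole : 'I_m -> set C).
Variable alpha : 'I_m -> R[i].
Hypothesis oOm : open Om.
Local Notation H2 := (H2 Om t0 hole alpha).
Local Notation N := (H2_normsq Om t0).

Lemma path_cat1 (g d : R -> C) : path_cat g d 1 = d 1.
Proof.
rewrite /path_cat leNgt invf_lt1 ?ltr0n // ltr1n /= mulr1.
by congr d; ring.
Qed.

Lemma segment1 (b w : C) : segment b w 1 = w.
Proof. by rewrite /segment rmorph1 mul1r addrC subrK. Qed.

(** A majorant comes from |a f + g|^2 <= 2 |a|^2 |f|^2 + 2 |g|^2. *)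
Lemma H2_lin (a : R[i]) (f g : mvfun R) :
  H2 f -> H2 g -> H2 (fun p => a * f p + g p).
Proof.
move=> [sf hf af [u [hu fu]]] [sg hg ag [v [hv gv]]].
split.
- move=> b p d pb db pd.
  by rewrite (sf b p d pb db pd) (sg b p d pb db pd).
- move=> b p r pb br w bw.
  have df := derivableZ (k := a) (hf b p r pb br w bw).
  exact: derivableD df (hg b p r pb br w bw).
- move=> l k b p ll pb wl.
  by rewrite (af l k b p ll pb wl) (ag l k b p ll pb wl) mulrDr mulrCA.
exists (fun z => (complex.Re (`|a| ^+ 2) *+ 2) * u z + 2 * v z).
split; first exact: harmonic_lin.
move=> b p pb; have uP := fu b p pb; have vP := gv b p pb.
rewrite realcD !realcM mulr2n realcD Re_normc2 -mulr2n.
apply: (@le_trans _ _ (`|a| ^+ 2 *+ 2 * `|f p| ^+ 2 + 2 * `|g p| ^+ 2)); last first.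
  rewrite lerD // ?rmorph_nat; first by rewrite ler_wpM2l // mulrn_wge0 // exprn_ge0.
  by rewrite [leRHS](_ : _ = 2 * (v b)%:C%C) ?ler_wpM2l // rmorph_nat.
have tri := ler_normD (a * f p) (g p).
have := lerXn2r 2 (normr_ge0 _) (addr_ge0 (normr_ge0 _) (normr_ge0 _)) tri.
move=> /le_trans; apply; rewrite normrM -subr_ge0.
set x := `|a|; set y := `|f p|; set w := `|g p|.
have -> : x ^+ 2 *+ 2 * y ^+ 2 + 2 * w ^+ 2 - (x * y + w) ^+ 2 = (x * y - w) ^+ 2.
  by ring.
rewrite real_exprn_even_ge0 // rpredB ?rpredM // ger0_real // normr_ge0 //.
Qed.

Lemma H2_0 : H2 (fun=> 0).
Proof.
split=> //.
- by move=> b p r pb br w bw; exact: derivable_cst.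
- by move=> l k b p _ _ _; rewrite mulr0.
exists (fun=> 0); split; first exact: harmonic0.
by move=> b p _; rewrite normr0 expr0n.
Qed.

Lemma H2_scale (a : R[i]) (f : mvfun R) : H2 f -> H2 (fun p => a * f p).
Proof.
move=> Hf; rewrite (_ : (fun p => _) = fun p => a * f p + 0); first exact: H2_lin H2_0.
by apply/funext => p; rewrite addr0.
Qed.

Lemma H2_mul (f : C -> C) (B : R) (h : mvfun R) :
  holomorphic_on Om f -> 0 <= B -> (forall z, Om z -> `|f z| <= B%:C%C) ->
  H2 h -> H2 (fun p => f (p 1) * h p).
Proof.
move=> holf B0 fB [sh hh ah [u [hu hP]]].
split.
- move=> b p d pb db pd; rewrite (sh b p d pb db pd).
  by case: pb => _ _ _ ->; case: db => _ _ _ ->.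
- move=> b p r pb br w bw.
  rewrite [X in derivable X](_ : _ = f * (fun w => h (path_cat p (segment b w)))).
    by apply: derivableM; [exact/holf/br|exact: hh bw].
  by apply/funext => x; rewrite path_cat1 segment1.
- move=> l k b p ll pb wl.
  by rewrite (ah l k b p ll pb wl) path_cat1 mulrCA.
exists (fun z => B ^+ 2 * u z); split; first exact: harmonic_scale.
move=> b p pb; rewrite realcM rmorphXn normrM exprMn.
have pOm : Om (p 1) by case: pb => _ + _ _; apply; rewrite /= in_itv /= lexx ler01.
rewrite ler_pM ?exprn_ge0 ?hP //.
by apply: lerXn2r; rewrite ?nnegrE ?normr_ge0 ?ler0c //; exact: (fB _ pOm).
Qed.

Hypothesis Omt0 : Om t0.

Lemma H2_normsqE (h : mvfun R) (u : C -> R) :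
  least_harmonic_majorant Om t0 h u -> N h = u t0.
Proof.
move=> hu; rewrite /H2_normsq; case: xgetP => [w _ hw|/(_ u)//].
apply/eqP; rewrite eq_le; apply/andP.
by split; [exact: (hw.2 _ hu.1 _ Omt0)|exact: (hu.2 _ hw.1 _ Omt0)].
Qed.

Lemma least_harmonic_majorantZ (c : R[i]) (h : mvfun R) (u : C -> R) : c != 0 ->
  least_harmonic_majorant Om t0 h u ->
  least_harmonic_majorant Om t0 (fun p => c * h p)
    (fun z => complex.Re (`|c| ^+ 2) * u z).
Proof.
have majZ (d : R[i]) (k : mvfun R) w : harmonic_majorant Om t0 k w ->
    harmonic_majorant Om t0 (fun p => d * k p)
      (fun z => complex.Re (`|d| ^+ 2) * w z).
  move=> [hw kw]; split; first exact: harmonic_scale.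
  move=> b p pb; rewrite realcM Re_normc2.
  by rewrite normrM exprMn ler_wpM2l ?exprn_ge0 // kw.
move=> c0 [hu lu]; split; first exact: majZ.
move=> w hw z Omz.
have : harmonic_majorant Om t0 h (fun z => complex.Re (`|c^-1| ^+ 2) * w z).
  rewrite (_ : h = fun p => c^-1 * (c * h p)); first exact: majZ.
  by apply/funext => p; rewrite mulKf.
move=> /lu /(_ z Omz).
have c20 : 0 < complex.Re (`|c| ^+ 2) by rewrite -ltcR Re_normc2 exprn_gt0 // normr_gt0.
have -> : complex.Re (`|c^-1| ^+ 2) = (complex.Re (`|c| ^+ 2))^-1.
  apply: (@complexI R); rewrite realcV !Re_normc2.
  by rewrite normfV exprVn.
by rewrite mulrC ler_pdivlMr // mulrC.
Qed.

(** Both sides are 0 when h has no least harmonic majorant, because c can be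
    divided out again. *)
Lemma H2_normsqZ (c : R[i]) (h : mvfun R) : c != 0 ->
  N (fun p => c * h p) = complex.Re (`|c| ^+ 2) * N h.
Proof.
move=> c0; have [[u hu]|nu] := pselect (exists u, least_harmonic_majorant Om t0 h u).
  by rewrite (H2_normsqE hu) (H2_normsqE (least_harmonic_majorantZ c0 hu)).
have N0 (k : mvfun R) : ~ (exists u, least_harmonic_majorant Om t0 k u) -> N k = 0.
  by move=> nk; rewrite /H2_normsq xgetPN // => w kw; apply: nk; exists w.
rewrite (N0 _ nu) mulr0; apply: N0 => -[u].
move=> /(least_harmonic_majorantZ (invr_neq0 c0)).
rewrite (_ : (fun p => _) = h); last by apply/funext => p; rewrite mulKf.
by move=> hu; apply: nu; eexists; exact: hu.
Qed.

End HardySpace.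

(** * Inner products with combinations of kernel functions *)

Section Polarization.
Variable R : realType.
Local Notation Re := (@complex.Re R).

(** The real part of a polarization sum only involves its terms of index 0 and 2;
    the left-hand side is that sum, unfolded. *)
Lemma Re_polarization (n0 n1 n2 n3 : R) (x : R[i]) :
  4^-1 * ('i%C ^+ 0 * n0%:C%C + ('i%C ^+ 1 * n1%:C%C +
    ('i%C ^+ 2 * n2%:C%C + ('i%C ^+ 3 * n3%:C%C + 0)))) = x ->
  n0 - n2 = 4 * Re x.
Proof.
move=> <-.
have -> : 'i%C ^+ 3 = - 'i%C :> R[i] by rewrite exprS sqr_i mulrN1.
rewrite sqr_i expr0 expr1 (_ : 4^-1 = (4^-1)%:C%C); last by rewrite realcV rmorph_nat.
by simpc; rewrite /=; field.
Qed.

(** The constant y cancels because the powers of i sum to 0, and the terms of index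
    0, 2 and of index 1, 3 give the real and the imaginary part of x. *)
Lemma polarization (f : R[i] -> R) (y : R) (x : R[i]) :
  (forall c, `|c| = 1 -> f c = y + 2 * Re (c^*%C * x)) ->
  4^-1 * \sum_(k < 4) 'i%C ^+ k * (f ('i%C ^+ k))%:C%C = x.
Proof.
move=> fE; under eq_bigr => k _ do rewrite fE ?normrX ?normc_i ?expr1n //.
rewrite !big_ord_recl big_ord0 /=.
have -> : 'i%C ^+ 3 = - 'i%C :> R[i] by rewrite exprS sqr_i mulrN1.
rewrite sqr_i expr0 expr1 (_ : 4^-1 = (4^-1)%:C%C); last by rewrite realcV rmorph_nat.
case: x {fE} => a b.
by simpc; apply/eqP; rewrite eq_complex /=; apply/andP; split; apply/eqP; field.
Qed.

End Polarization.

Section Kernel.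
Variable R : realType.
Local Notation C := (R[i]^o).
Local Notation Re := (@complex.Re R).
Variables (Om : set C) (t0 : C) (m : nat) (hole : 'I_m -> set C).
Variable alpha : 'I_m -> R[i].
Hypotheses (oOm : open Om) (Omt0 : Om t0).
Local Notation H2 := (H2 Om t0 hole alpha).
Local Notation N := (H2_normsq Om t0).
Variable K : (R -> C) -> (R -> C) -> R[i].
Hypothesis Krep : reproducing_kernel Om t0 hole alpha K.

(** The quadratic expansion of the squared norm along one kernel function k. The
    reproducing property gives N(h + k) - N(h - k) = 4 Re h(d) for every h in H2.
    At h + k it reads N(h + 2 k) = N(h) + 4 Re (h(d) + k(d)); applied to
    2 / be * h and rescaled by be / 2, this is the general formula. *)
Lemma H2_normsq_kernel (b : C) (d : R -> C) (be : R[i]) (h : mvfun R) :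
  is_path Om t0 b d -> H2 h ->
  N (fun p => be * K p d + h p) =
  N h + 2 * Re (be^*%C * h d) + Re (`|be| ^+ 2) * Re (K d d).
Proof.
move=> bd Hh; have [Hk rep] := Krep bd.
have [->|be0] := eqVneq be 0.
  rewrite (_ : (fun p => _) = h); last by apply/funext => p; rewrite mul0r add0r.
  by rewrite normr0 expr0n conjc0 mul0r /= mulr0 mul0r !addr0.
have L1 g : H2 g -> N (fun p => K p d + g p) - N (fun p => - K p d + g p) = 4 * Re (g d).
  move=> /rep; rewrite /H2_inner !big_ord_recl big_ord0 => /Re_polarization <-.
  by congr (N _ - N _); apply/funext => p /=; rewrite ?expr0 ?sqr_i ?mul1r ?mulN1r addrC.
pose g p := 2 / be * h p.
have Hg : H2 g by exact: H2_scale.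
have Hgk : H2 (fun p => K p d + g p).
  rewrite (_ : (fun p => _) = fun p => 1 * K p d + g p); first exact: H2_lin.
  by apply/funext => p; rewrite mul1r.
have Ng : N g = Re (`|2 / be| ^+ 2) * N h.
  by rewrite /g (H2_normsqZ oOm Omt0) // mulf_neq0 ?invr_neq0.
have be20 : be / 2 != 0 by rewrite mulf_neq0 ?invr_neq0.
have := L1 _ Hgk.
rewrite (_ : (fun p => - K p d + _) = g); last first.
  by apply/funext => p; rewrite addKr.
rewrite Ng => /eqP; rewrite subr_eq => /eqP E.
have -> : (fun p => be * K p d + h p) =
    (fun p => be / 2 * (K p d + (K p d + g p))).
  by apply/funext => p; rewrite /g; field.
rewrite (H2_normsqZ oOm Omt0) // E mulrDr mulrA.
have -> : Re (`|be / 2| ^+ 2) = Re (`|be| ^+ 2) / 4.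
  rewrite normf_div normr_nat expr_div_n.
  rewrite (_ : 2 ^+ 2 = 4%:C%C); last by rewrite -natrX rmorph_nat.
  rewrite -(Re_normc2 be).
  by rewrite -realcV -realcM.
have -> : Re (`|2 / be| ^+ 2) = 4 / Re (`|be| ^+ 2).
  rewrite normf_div normr_nat expr_div_n.
  rewrite (_ : 2 ^+ 2 = 4%:C%C); last by rewrite -natrX rmorph_nat.
  rewrite -(Re_normc2 be).
  by rewrite -realcV -realcM.
rewrite /g.
have be2 : Re (`|be| ^+ 2) != 0.
  apply/negP => /eqP e; move: be0; rewrite -normr_eq0 -sqrf_eq0.
  by rewrite -(Re_normc2 be) e eqxx.
have -> : be^*%C * h d = (Re (`|be| ^+ 2))%:C%C * (be^-1 * h d).
  rewrite (Re_normc2 be) sqr_normc.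
  by rewrite mulrAC mulrA divff // mul1r mulrC.
have ReM (x : R) (y : R[i]) : Re (x%:C%C * y) = x * Re y.
  by case: y => y1 y2; simpc.
move: (Re (`|be| ^+ 2)) be2 => B be2.
have -> : 2 / be * h d = (2 : R)%:C%C * (be^-1 * h d) by rewrite rmorph_nat mulrA.
rewrite (raddfD _ : forall x y, Re (x + y) = Re x + Re y) !ReM.
by field.
Qed.

Implicit Type s : seq (R[i] * (R -> C)).

Definition kernel_sum s : mvfun R := fun p => \sum_(x <- s) x.1 * K p x.2.

(** The value that sesquilinearity predicts for the inner product of h with
    kernel_sum s. *)
Definition kernel_eval s (h : mvfun R) : R[i] := \sum_(x <- s) x.1^*%C * h x.2.

Definition over_paths s := forall x, x \in s -> exists b, is_path Om t0 b x.2.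

Lemma over_paths_cons x s : over_paths (x :: s) ->
  (exists b, is_path Om t0 b x.2) /\ over_paths s.
Proof.
by move=> xs; split=> [|y ys]; apply: xs; rewrite inE ?eqxx // ys orbT.
Qed.

(** Adding one kernel function at a time, each step being an instance of the
    one-kernel expansion. The factor c is what polarization needs. *)
Lemma H2_normsq_kernel_sum s : over_paths s -> exists q : R,
  forall (c : R[i]) (h : mvfun R), H2 h ->
  N (fun p => h p + c * kernel_sum s p) =
  N h + 2 * Re (c^*%C * kernel_eval s h) + Re (`|c| ^+ 2) * q.
Proof.
rewrite /kernel_sum /kernel_eval; elim: s => [_|[be d] s IH].
  exists 0 => c h _; under eq_fun do rewrite big_nil mulr0 addr0.
  by rewrite big_nil !mulr0 !addr0.
move=> /over_paths_cons[[b bd] /IH[q qP]]; rewrite -[(be, d).2]/d in bd.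
pose L := \sum_(x <- s) x.1^*%C * K x.2 d.
exists (q + Re (`|be| ^+ 2) * Re (K d d) + 2 * Re (be * L)) => c h Hh.
have [Hk _] := Krep bd.
have Hk' : H2 (fun p => c * be * K p d + h p) by exact: H2_lin.
rewrite (_ : (fun p => _) = fun p =>
    (c * be * K p d + h p) + c * (\sum_(x <- s) x.1 * K p x.2)); last first.
  by apply/funext => p; rewrite big_cons /=; ring.
rewrite qP // (H2_normsq_kernel _ bd Hh) !sqr_normc big_cons /=.
rewrite (_ : \sum_(x <- s) _ = c * be * L + \sum_(x <- s) x.1^*%C * h x.2); last first.
  rewrite /L mulr_sumr -big_split /=; apply: eq_bigr => x _; ring.
move: (\sum_(x <- s) _) L (h d) (K d d) => X L' Y Z.
case: c Hk' => c1 c2 _; case: be => b1 b2; case: X => x1 x2; case: L' => l1 l2.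
case: Y => y1 y2; simpc; rewrite /=; ring.
Qed.

(** The terms of the expansion that do not depend on the phase of c cancel in the
    polarization sum, which leaves the linear term. *)
Lemma H2_inner_kernel_sum s (h : mvfun R) : over_paths s -> H2 h ->
  H2_inner Om t0 h (kernel_sum s) = kernel_eval s h.
Proof.
move=> /H2_normsq_kernel_sum[q qP] Hh; rewrite /H2_inner.
pose f c := N (fun p => h p + c * kernel_sum s p).
apply: (@polarization _ f (N h + q)) => c c1.
by rewrite /f qP // c1 expr1n /= mul1r addrAC.
Qed.

Lemma H2_kernel_sum s : over_paths s -> H2 (kernel_sum s).
Proof.
elim: s => [_|[be d] s IH /over_paths_cons[[b bd] /IH sP]].
  rewrite (_ : kernel_sum _ = fun=> 0); first exact: H2_0.
  by apply/funext => p; rewrite /kernel_sum big_nil.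
have [Hk _] := Krep bd.
rewrite (_ : kernel_sum _ = fun p => be * K p d + kernel_sum s p).
  exact: H2_lin.
by apply/funext => p; rewrite /kernel_sum big_cons.
Qed.

End Kernel.

(** * The functional calculus *)

Section Calculus.
Variable R : realType.
Local Notation C := (R[i]^o).
Variables (Om : set C) (n : nat) (V : vectType R[i]).
Variable dot : {dot V for @Num.conj R[i]}.
Variables (T Tstar : 'End(V)) (z : 'I_n -> R[i]) (v : 'I_n -> V).
Hypothesis dimV : \dim {:V} = n.
Hypothesis zinj : injective z.
Hypothesis zOm : forall i, Om (z i).
Hypothesis eigT : forall i, passmx.leigenvalue T (z i).
Hypothesis adjT : is_adjoint dot T Tstar.
Hypothesis freev : free [tuple v i | i < n].
Hypothesis eigTstar : forall i, Tstar (v i) = Num.conj (z i) *: v i.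

Local Notation nrm u := (sqrtC (dot u u)).

Lemma nrm_sum (I : Type) (r : seq I) (F : I -> V) :
  nrm (\sum_(i <- r) F i) <= \sum_(i <- r) nrm (F i).
Proof.
elim/big_ind2: _ => [|u a w b ha hb|//]; first by rewrite linear0l sqrtC0.
by rewrite (le_trans (triangle_lerif _ _ _)) // lerD.
Qed.

Lemma nrmZ (a : R[i]) (u : V) : nrm (a *: u) = `|a| * nrm u.
Proof.
by rewrite dnormZ sqrtCM ?nnegrE ?dnorm_ge0 ?exprn_ge0 // sqrCK.
Qed.

Lemma v_basis : basis_of fullv [tuple v i | i < n].
Proof. by rewrite basisEfree freev subvf size_tuple dimV leqnn. Qed.

Local Notation co i u := (coord [tuple v i | i < n] i u).

Lemma coord_v (u : V) : u = \sum_i co i u *: v i.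
Proof.
rewrite {1}(coord_basis v_basis (memvf u)); apply: eq_bigr => i _.
by rewrite -tnth_nth tnth_mktuple.
Qed.

Lemma dot_sumr (u : V) (b : 'I_n -> R[i]) :
  dot u (\sum_i b i *: v i) = \sum_i Num.conj (b i) * dot u (v i).
Proof. by rewrite linear_sumr; apply: eq_bigr => i _; rewrite linearZr_LR. Qed.

Lemma dot_coordr (u w : V) :
  dot u w = \sum_i Num.conj (co i w) * dot u (v i).
Proof. by rewrite [X in dot _ X](coord_v w) dot_sumr. Qed.

Lemma dot_separates (u w : V) : (forall j, dot u (v j) = dot w (v j)) -> u = w.
Proof.
move=> uw; apply/eqP; rewrite -subr_eq0 -(dnorm_eq0 dot) dot_coordr big1 // => i _.
by rewrite linearBl /= uw subrr mulr0.
Qed.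

Lemma dot_T u j : dot (T u) (v j) = z j * dot u (v j).
Proof. by rewrite adjT eigTstar linearZr_LR /= conjCK. Qed.

Lemma dot_poly_lfun p u j : dot (poly_lfun p T u) (v j) = p.[z j] * dot u (v j).
Proof.
rewrite /poly_lfun sum_lfunE linear_sumlz horner_coef mulr_suml.
apply: eq_bigr => i _; rewrite scale_lfunE linearZl_LR /= -mulrA; congr (_ * _).
elim: (nat_of_ord i) => [|k IH] /=; first by rewrite id_lfunE mul1r.
by rewrite comp_lfunE dot_T IH exprS mulrA.
Qed.

(** The adjoint acts on v j by a scalar, so pairing with v j turns operators built
    from T into their values at z j. *)
Lemma dot_rat_lfun (r : {poly R[i]} * {poly R[i]}) u j :
  poles_off_closure Om r ->
  dot (rat_lfun r T u) (v j) = rat_eval r (z j) * dot u (v j).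
Proof.
move=> pr; have r20 k : r.2.[z k] != 0 by apply: pr; apply: subset_closure.
have ker0 : lker (poly_lfun r.2 T) == 0%VS.
  apply/lker0P => x y xy; apply: dot_separates => k.
  by apply: (mulfI (r20 k)); rewrite -!dot_poly_lfun xy.
rewrite /rat_lfun comp_lfunE dot_poly_lfun /rat_eval -mulrA; congr (_ * _).
by apply: (mulfI (r20 j)); rewrite -dot_poly_lfun lker0_lfunVK // mulVKf.
Qed.

(** Pairing with v j shows that an eigenvector of T for z i is orthogonal to the
    v j with j different from i; it cannot be orthogonal to v i as well. *)
Lemma dual_basis : exists e : 'I_n -> V, forall i j, dot (e i) (v j) = (i == j)%:R.
Proof.
suff /choice[e eP] : forall i, exists x, forall j, dot x (v j) = (i == j)%:R by exists e.
move=> i; have := eigT i.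
rewrite /passmx.leigenvalue -vpick0 => w0.
set w := vpick _ in w0.
have wE : T w = z i *: w.
  have := memv_pick (passmx.leigenspace T (z i)); rewrite -/w.
  by rewrite /passmx.leigenspace memv_ker !lfun_simp subr_eq0 => /eqP.
have wj j : i != j -> dot w (v j) = 0.
  move=> ij; have := dot_T w j; rewrite wE linearZl_LR /= => /eqP.
  rewrite -subr_eq0 -mulrBl mulf_eq0 subr_eq0 => /orP[/eqP/zinj/eqP|/eqP//].
  by rewrite (negbTE ij).
have wi : dot w (v i) != 0.
  apply: contraNneq w0 => w0; apply/eqP/dot_separates => j.
  rewrite linear0l; have [<-//|ij] := eqVneq i j; exact: wj.
exists ((dot w (v i))^-1 *: w) => j; rewrite linearZl_LR /=.
have [<-|ij] := eqVneq i j; first by rewrite mulVf.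
by rewrite (wj _ ij) mulr0.
Qed.

(** In the dual basis all r k (T) are diagonal with entries r k (z i), so they
    converge to the diagonal operator with entries f (z i). *)
Lemma rat_lfun_cvg r f : rat_approx Om r f ->
  exists F : 'End(V), lfun_cvg dot (fun k => rat_lfun (r k) T) F.
Proof.
move=> rf; have [pr _] := rf; have [e eP] := dual_basis.
have eE u : u = \sum_i dot u (v i) *: e i.
  apply: dot_separates => j; rewrite linear_sumlz (bigD1 j) //=.
  rewrite linearZl_LR /= eP eqxx mulr1 big1 ?addr0 // => i ij.
  by rewrite linearZl_LR /= eP (negbTE ij) mulr0.
pose F0 u := \sum_i (f (z i) * dot u (v i)) *: e i.
have F0lin : linear F0.
  move=> a u w; rewrite /F0 scaler_sumr -big_split /=; apply: eq_bigr => i _.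
  by rewrite linearPl /= mulrDr scalerDl scalerA mulrCA.
pose F0m := GRing.isLinear.Build _ _ _ _ F0 F0lin.
pose F0L : {linear V -> V} := HB.pack F0 F0m.
exists (linfun F0L) => d d0.
pose S := \sum_i nrm (v i) * nrm (e i).
have S0 : 0 <= S by apply: sumr_ge0 => i _; rewrite mulr_ge0 // sqrt_dnorm_ge0.
have S1 : 0 < S + 1 by rewrite ltr_wpDl.
have dS : 0 < d / (S + 1) by rewrite divr_gt0.
have := rat_approxP rf dS; apply: filterS => k kP u.
set w := fun_of_lfun _ u.
have -> : w = \sum_i ((rat_eval (r k) (z i) - f (z i)) * dot u (v i)) *: e i.
  have -> : w = rat_lfun (r k) T u - F0 u.
    by rewrite /w add_lfunE opp_lfunE (lfunE F0L).
  rewrite {1}(eE (rat_lfun (r k) T u)).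
  rewrite /F0 -sumrB; apply: eq_bigr => i _.
  by rewrite dot_rat_lfun // -scalerBl -mulrBl.
set x := \sum_i _.
have nx : nrm x <= d * nrm u.
  rewrite (le_trans (nrm_sum _ _)) //.
  apply: (@le_trans _ _ (\sum_i d / (S + 1) * nrm u * (nrm (v i) * nrm (e i)))).
    apply: ler_sum => i _; rewrite nrmZ normrM mulrA.
    rewrite ler_wpM2r ?sqrt_dnorm_ge0 // -(mulrA (d / _)) ler_pM //.
      by rewrite distrC; exact/ltW/kP.
    exact: (CauchySchwarz_sqrt dot u (v i)).
  rewrite -mulr_sumr -/S mulrAC ler_wpM2r ?sqrt_dnorm_ge0 //.
  rewrite mulrAC -mulrA -[leRHS]mulr1 (ler_wpM2l (ltW d0)) //.
  by rewrite ler_pdivrMr // mul1r lerDl ler01.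
rewrite -[leLHS]sqrtCK -[dot u u]sqrtCK -exprMn.
apply: lerXn2r => //; rewrite nnegrE ?sqrt_dnorm_ge0 //.
by rewrite mulr_ge0 ?sqrt_dnorm_ge0 // ltW.
Qed.

(** The value of rho is some limit of operators r k (T); testing it against v j
    identifies it, since the values r k (z j) converge to f (z j). *)
Lemma dot_rho f u j : algebraA Om f ->
  dot (rho Om dot T f u) (v j) = f (z j) * dot u (v j).
Proof.
move=> [r0 rf0]; rewrite /rho; case: xgetP => [F _ [r rf rF]|]; last first.
  have [F0 F0P] := rat_lfun_cvg rf0.
  by move=> /(_ F0) []; exists r0.
have [pr _] := rf.
apply/eqP; rewrite -subr_eq0 -normr_le0; apply/ler_addgt0Pr => d d0; rewrite add0r.
pose A := nrm u * nrm (v j) + `|dot u (v j)|.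
have A0 : 0 <= A by rewrite addr_ge0 // mulr_ge0 // sqrt_dnorm_ge0.
have A1 : 0 < A + 1 by rewrite ltr_wpDl.
have dA : 0 < d / (A + 1) by rewrite divr_gt0.
have [k []] : exists k, (forall x, Om x -> `|f x - rat_eval (r k) x| < d / (A + 1)) /\
    (forall w, dot ((rat_lfun (r k) T - F) w) ((rat_lfun (r k) T - F) w) <=
       (d / (A + 1)) ^+ 2 * dot w w).
  have [N _ NP] := filterI (rat_approxP rf dA) (rF _ dA).
  by exists N; apply: NP => /=.
move=> /(_ (z j) (zOm j)) h1 /(_ u) h2.
have -> : dot (F u) (v j) - f (z j) * dot u (v j) =
   - dot ((rat_lfun (r k) T - F) u) (v j) - (f (z j) - rat_eval (r k) (z j)) * dot u (v j).
  rewrite add_lfunE opp_lfunE linearBl /= dot_rat_lfun //; ring.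
rewrite (le_trans (ler_normB _ _)) // normrN normrM.
have h3 : `|dot ((rat_lfun (r k) T - F) u) (v j)| <= d / (A + 1) * (nrm u * nrm (v j)).
  rewrite (le_trans (CauchySchwarz_sqrt dot _ _)) // mulrA.
  rewrite ler_wpM2r ?sqrt_dnorm_ge0 //.
  rewrite -ler_sqr ?nnegrE ?mulr_ge0 ?sqrt_dnorm_ge0 ?(ltW d0) ?invr_ge0 ?(ltW A1) //.
  by rewrite exprMn !sqrtCK.
rewrite (le_trans (lerD h3 (ler_wpM2r (normr_ge0 _) (ltW h1)))) //.
rewrite -mulrDr -/A mulrAC -mulrA -[leRHS]mulr1 (ler_wpM2l (ltW d0)) //.
by rewrite ler_pdivrMr // mul1r lerDl ler01.
Qed.

End Calculus.

(** * The dilation *)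

Section Embedding.
Variable R : realType.
Local Notation C := (R[i]^o).
Variables (Om : set C) (t0 : C) (m : nat) (hole : 'I_m -> set C).
Variable alpha : 'I_m -> R[i].
Hypotheses (oOm : open Om) (Omt0 : Om t0).
Variable Ka : (R -> C) -> (R -> C) -> R[i].
Hypothesis Krep : reproducing_kernel Om t0 hole alpha Ka.
Variables (n : nat) (V : vectType R[i]) (dot : {dot V for @Num.conj R[i]}).
Variables (z : 'I_n -> R[i]) (v : 'I_n -> V) (c : 'I_n -> R -> C).
Variable a : 'I_n -> 'rV[R[i]]_n.
Hypothesis dimV : \dim {:V} = n.
Hypothesis freev : free [tuple v i | i < n].
Hypothesis cP : forall i, is_path Om t0 (z i) (c i).
Hypothesis Gram : forall i j,
  dot (v i) (v j) = Ka (c j) (c i) * \sum_k a i 0 k * Num.conj (a j 0 k).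

Local Notation co i u := (coord [tuple v i | i < n] i u).

(** The linear map sending v i to the tensor product of the kernel function at
    c i and the vector a i. *)
Definition embed (u : V) : 'I_n -> mvfun R := fun k =>
  kernel_sum Ka [seq (co i u * a i 0 k, c i) | i <- enum 'I_n].

(** The inner product of y with the image of v j under the embedding. *)
Definition frame_eval (y : 'I_n -> mvfun R) (j : 'I_n) : R[i] :=
  \sum_k Num.conj (a j 0 k) * y k (c j).

Lemma embedE u k p : embed u k p = \sum_i co i u * a i 0 k * Ka p (c i).
Proof. by rewrite /embed /kernel_sum big_map big_enum. Qed.

Lemma over_paths_embed u k :
  over_paths Om t0 [seq (co i u * a i 0 k, c i) | i <- enum 'I_n].
Proof. by move=> x /mapP[i _ ->]; exists (z i); exact: cP. Qed.

Lemma H2n_embed u : H2n Om t0 hole alpha (embed u).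
Proof. by move=> k; apply: (H2_kernel_sum oOm Krep); exact: over_paths_embed. Qed.

Lemma embed_lin (b : R[i]) u w k p :
  embed (b *: u + w) k p = b * embed u k p + embed w k p.
Proof.
rewrite !embedE mulr_sumr -big_split; apply: eq_bigr => i _.
rewrite linearP /=; ring.
Qed.

Lemma H2n_inner_embed y w : H2n Om t0 hole alpha y ->
  H2n_inner Om t0 y (embed w) = \sum_j Num.conj (co j w) * frame_eval y j.
Proof.
move=> Hy; under [RHS]eq_bigr do rewrite mulr_sumr.
rewrite exchange_big; apply: eq_bigr => k _.
rewrite (H2_inner_kernel_sum oOm Omt0 Krep (@over_paths_embed w k) (Hy k)).
rewrite /kernel_eval big_map big_enum; apply: eq_bigr => j _ /=.
by rewrite mulrA -rmorphM.
Qed.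

(** Both sides are the same combination of entries of the Gram matrix of v, which
    is the Schur product of the kernel with that of a. *)
Lemma frame_eval_embed u j : frame_eval (embed u) j = dot u (v j).
Proof.
rewrite {2}(coord_v dimV freev u) linear_sumlz /frame_eval.
under eq_bigr do rewrite embedE mulr_sumr.
rewrite exchange_big; apply: eq_bigr => i _ /=.
rewrite linearZl_LR /= Gram !mulr_sumr; apply: eq_bigr => k _.
ring.
Qed.

Lemma embed_isometry u w : H2n_inner Om t0 (embed u) (embed w) = dot u w.
Proof.
rewrite H2n_inner_embed; last exact: H2n_embed.
rewrite (dot_coordr dot dimV freev u w).
by apply: eq_bigr => j _; rewrite frame_eval_embed.
Qed.

(** M_f multiplies the pairing with the image of v j by f (z j), which is also the
    factor between the pairings of u and w with v j. *)
Lemma embed_orth_proj (f : C -> C) (u w : V) :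
  H2n Om t0 hole alpha (mult_op f (embed u)) ->
  (forall j, dot w (v j) = f (z j) * dot u (v j)) ->
  orth_proj Om t0 (range embed) (mult_op f (embed u)) (embed w).
Proof.
move=> Hf wf; split; first by exists w.
move=> _ [x _ <-]; rewrite H2n_inner_embed.
  apply: big1 => j _.
  rewrite (_ : frame_eval _ j = f (z j) * frame_eval (embed u) j - frame_eval (embed w) j).
    by rewrite !frame_eval_embed wf subrr mulr0.
  rewrite /frame_eval mulr_sumr -sumrB; apply: eq_bigr => k _.
  by rewrite /mult_op; case: (cP j) => _ _ _ ->; ring.
move=> k; rewrite (_ : (fun p => _) = fun p => -1 * embed w k p + mult_op f (embed u) k p).
  apply: H2_lin => //; exact: H2n_embed.
by apply/funext => p; ring.
Qed.

End Embedding.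

Theorem corollary12 (R : realType) (Om : set R[i]^o) (m : nat)
    (hole : 'I_m -> set R[i]^o) (t0 : R[i]^o)
    (n : nat) (V : vectType R[i]) (dot : {dot V for @Num.conj R[i]})
    (T Tstar : 'End(V)) (z : 'I_n -> R[i]) (v : 'I_n -> V)
    (K : R[i] -> R[i] -> R[i]) (c : 'I_n -> R -> R[i]^o) :
  analytic_domain Om hole ->
  Om t0 ->
  \dim {:V} = n ->
  injective z ->
  (forall i, Om (z i)) ->
  (forall i, passmx.leigenvalue T (z i)) ->
  is_adjoint dot T Tstar ->
  free [tuple v i | i < n] ->
  (forall i, Tstar (v i) = Num.conj (z i) *: v i) ->
  (forall i j, K (z j) (z i) = dot (v i) (v j)) ->
  (forall i, is_path Om t0 (z i) (c i)) ->
  (exists (alpha : 'I_m -> R[i]) (Kalpha : (R -> R[i]^o) -> (R -> R[i]^o) -> R[i])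
          (A : 'M[R[i]]_n),
     [/\ unimodular alpha,
         reproducing_kernel Om t0 hole alpha Kalpha,
         positive_definite A
       & forall i j, K (z j) (z i) = Kalpha (c j) (c i) * A i j]) ->
  exists2 alpha : 'I_m -> R[i],
    unimodular alpha & dilatable Om t0 hole alpha n dot T.
Proof.
move=> dom Omt0 dimV zinj zOm eigT adjT freev eigTs KE cP.
move=> [alpha [Ka [A [alpha1 Krep [a aE] KA]]]].
have oOm := domain_open dom.
have Hmul f (x : 'I_n -> mvfun R) : algebraA Om f ->
    H2n Om t0 hole alpha x -> H2n Om t0 hole alpha (mult_op f x).
  move=> fA Hx k.
  have [B B0 fB] := algebraA_bounded (domain_nonempty dom) (domain_bounded dom) fA.
  exact: (H2_mul oOm (algebraA_holomorphic oOm fA) B0 fB (Hx k)).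
have Gram i j : dot (v i) (v j) =
    Ka (c j) (c i) * \sum_k a i 0 k * Num.conj (a j 0 k).
  by rewrite -KE KA aE.
exists alpha => //; split=> //; exists (embed Ka v c a); split.
- by move=> u; exact: (H2n_embed oOm Krep).
- by move=> b u w k p; exact: embed_lin.
- by move=> u w; exact: (embed_isometry oOm Omt0 Krep dimV freev cP Gram).
move=> f fA u.
apply: (embed_orth_proj oOm Omt0 Krep dimV freev cP Gram).
  by apply: Hmul => //; exact: (H2n_embed oOm Krep).
by move=> j; exact: (dot_rho dimV zinj zOm eigT adjT freev eigTs).
Qed.
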